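(* Let $s,t\in\mathbb N$ and let $\sigma$ be an $s$-core. For $k\in\mathbb N$ let $$N_\sigma(k)=\#\{\lambda\in\mathcal C_{st}\ :\ \mathrm{core}_s\lambda=\sigma,\ \ell(\lambda)\le k\}.$$ Then there is a quasipolynomial $Q_\sigma(k)$ of degree $s(t-1)$ and period $s$ such that $N_\sigma(k)=Q_\sigma(k)$ for all integers $k\ge\ell(\sigma)$. The leading coefficient of $Q_\sigma$ is $\dfrac{1}{((t-1)!)^s}$.
   Context: A partition $\lambda=(a_1,\dots,a_\ell)$ is a weakly decreasing finite sequence of positive integers; $\ell(\lambda)=\ell$ is its length (the empty partition has length $0$). For $t\in\mathbb N$, a $t$-core is a partition whose Young diagram contains no hook of size (hooklength) $t$; $\mathcal C_t$ denotes the set of $t$-cores. $\mathrm{core}_t\lambda$ is the partition obtained from $\lambda$ by successively removing rim hooks (border strips) of size $t$ until none remain (independent of choices). A function $Q:\mathbb N\to\mathbb Q$ is a quasipolynomial of period $p$ if for each $0\le i<p$ the function $n\mapsto Q(i+np)$ ($n\ge 0$) is a polynomial $P_i$; its degree is the maximum degree of the $P_i$. ''The leading coefficient of $Q$ is $c$'' means each $P_i$ (for the stated period) has degree equal to that of $Q$ and leading coefficient $c$. *)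

(* Defs.v *)
From mathcomp Require Import all_boot all_order all_algebra.
Set Implicit Arguments. Unset Strict Implicit. Unset Printing Implicit Defensive.
Import GRing.Theory Num.Theory.

(* A partition is a weakly decreasing finite sequence of positive integers;
   its length is [size lam]. Rows and columns are indexed from 0. *)
Definition is_partition (lam : seq nat) : bool :=
  sorted geq lam && all (fun a => 0 < a) lam.

Definition part (lam : seq nat) (i : nat) : nat := nth 0 lam i.

Definition conj_part (lam : seq nat) (j : nat) : nat := count (fun a => j < a) lam.

Definition in_diagram (lam : seq nat) (c : nat * nat) : bool := c.2 < part lam c.1.

Definition hook_length (lam : seq nat) (i j : nat) : nat :=
  (part lam i - j.+1) + (conj_part lam j - i.+1) + 1.

Definition is_core (t : nat) (lam : seq nat) : Prop :=
  forall i j, in_diagram lam (i, j) -> hook_length lam i j <> t.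

Definition in_skew (lam mu : seq nat) (c : nat * nat) : bool :=
  (part mu c.1 <= c.2) && (c.2 < part lam c.1).

Definition adjacent (c d : nat * nat) : bool :=
  ((c.1 == d.1) && ((c.2.+1 == d.2) || (d.2.+1 == c.2))) ||
  ((c.2 == d.2) && ((c.1.+1 == d.1) || (d.1.+1 == c.1))).

Definition skew_connected (lam mu : seq nat) : Prop :=
  forall c d, in_skew lam mu c -> in_skew lam mu d ->
    exists p : seq (nat * nat),
      [/\ path adjacent c p, last c p = d & all (in_skew lam mu) p].

Definition skew_no_2x2 (lam mu : seq nat) : Prop :=
  forall i j, ~ (in_skew lam mu (i, j) /\ in_skew lam mu (i.+1, j) /\
                 in_skew lam mu (i, j.+1) /\ in_skew lam mu (i.+1, j.+1)).

Definition skew_size (lam mu : seq nat) : nat :=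
  \sum_(i < size lam) (part lam i - part mu i).

Definition rim_hook_removal (t : nat) (lam mu : seq nat) : Prop :=
  [/\ is_partition mu, size mu <= size lam,
      (forall i, part mu i <= part lam i) &
      [/\ skew_size lam mu = t, skew_connected lam mu & skew_no_2x2 lam mu]].

Inductive rh_reach (t : nat) : seq nat -> seq nat -> Prop :=
  | rh_refl lam : rh_reach t lam lam
  | rh_step lam mu nu : rim_hook_removal t lam mu -> rh_reach t mu nu -> rh_reach t lam nu.

(* core_t lam = sigma : sigma is a t-core obtained from lam by successively
   removing rim hooks of size t (the result is independent of choices). *)
Definition core_is (t : nat) (lam sigma : seq nat) : Prop :=
  rh_reach t lam sigma /\ is_core t sigma.

(* Main.v *)
Require Import Defs.
From mathcomp Require Import all_boot all_order all_algebra.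
From mathcomp Require Import zify.
Import GRing.Theory Num.Theory.

(** Encode a partition with at most [k] parts by its [k] beads
    [part lam i + k - 1 - i], and sort the beads into runners modulo [s].
    Removing a rim hook of size [s] exchanges a bead [x] for [x - s], so it keeps
    the number of beads on each runner, and [lam] is an [s]-core iff its beads
    are closed under [x |-> x - s]. An [s * t]-core is thus an arbitrary choice of
    bead numbers on the [s * t] runners modulo [s * t]; its [s]-core is [sigma] iff
    on the [t] runners lying over each residue [r] modulo [s] these numbers add up
    to the number [c_r] of beads of [sigma] on runner [r]. Hence
    [N_sigma(k) = \prod_(r < s) 'C(t - 1 + c_r, t - 1)], and replacing [k] by
    [k + s] increases every [c_r] by one. *)

#[local] Arguments part : simpl never.

(** * Rows and columns of a partition *)

Lemma partition_cons a l :
  is_partition (a :: l) = [&& 0 < a, all (geq a) l & is_partition l].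
Proof.
rewrite /is_partition /= path_sortedE; last by move=> x y z /=; lia.
by case: (0 < a); case: all; case: sorted; rewrite /= ?andbF.
Qed.

Lemma part_anti lam i j : is_partition lam -> i <= j -> part lam j <= part lam i.
Proof.
elim: lam i j => [|a l IH] i j; first by rewrite /part !nth_nil.
rewrite partition_cons => /and3P[_ /allP ha hl].
case: j => [|j]; first by case: i.
case: i => [|i] hij; last exact: IH.
rewrite /part /=; case: (ltnP j (size l)) => hj; last by rewrite nth_default.
exact: ha (mem_nth _ hj).
Qed.

Lemma part_default lam i : size lam <= i -> part lam i = 0.
Proof. exact: nth_default. Qed.

Lemma ltn_size_part lam i : is_partition lam -> (i < size lam) = (0 < part lam i).
Proof.
case/andP=> _ /allP h; case: ltnP => hi; last by rewrite part_default.
by apply/esym/h/mem_nth.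
Qed.

(** Rows weakly decrease, so those longer than [j] form an initial segment, and counting them
    locates its end. *)
Lemma ltn_conj_part lam i j :
  is_partition lam -> (i < conj_part lam j) = (j < part lam i).
Proof.
elim: lam i => [|a l IH] i; first by rewrite /part nth_nil.
rewrite partition_cons => /and3P[_ /allP ha hl].
rewrite /conj_part /= -/(conj_part l j); case: i => [|i] /=; last first.
  rewrite -[j < part _ _]/(j < part l i) -(IH i hl).
  case: (ltnP j a) => ja; first by rewrite add1n ltnS.
  suff -> : conj_part l j = 0 by [].
  apply/eqP; rewrite -leqn0 leqNgt -has_count -all_predC; apply/allP => x /ha /=.
  lia.
rewrite /part /=; case: (ltnP j a) => ja //.
rewrite (IH 0 hl); apply/negbTE; rewrite -leqNgt /part.
case: (ltnP 0 (size l)) => hj; last by rewrite nth_default.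
by apply: leq_trans ja; apply: ha (mem_nth _ hj).
Qed.

(** The zeros of a weakly decreasing sequence all stand at its end, where the default value of [nth]
    replaces them. *)
Lemma nth_filter_gt0 l i :
  sorted geq l -> nth 0 (filter (ltn 0) l) i = nth 0 l i.
Proof.
elim: l i => //= a l IH i.
rewrite path_sortedE; last by move=> x y z /=; lia.
move=> /andP[/allP ha hl]; case: (posnP a) => a0 /=; last by case: i => //= i; apply: IH.
have z0 m : nth 0 l m = 0.
  case: (ltnP m (size l)) => hm; last by rewrite nth_default.
  by have := ha _ (mem_nth 0 hm); rewrite /= a0 leqn0 => /eqP.
by rewrite IH // z0 a0; case: i => //= i; rewrite z0.
Qed.

Lemma partition_exists (f : nat -> nat) k :
    (forall i, f i.+1 <= f i) -> (forall i, k <= i -> f i = 0) ->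
  exists mu, [/\ is_partition mu, size mu <= k & part mu =1 f].
Proof.
move=> fdec f0; have fs : sorted geq (mkseq f k).
  by apply/(sortedP 0) => i; rewrite size_mkseq => hi; rewrite !nth_mkseq //=; lia.
exists (filter (ltn 0) (mkseq f k)); split.
- rewrite /is_partition sorted_filter ?filter_all //.
  by move=> x y z /=; lia.
- by rewrite size_filter -[X in _ <= X](size_mkseq f) count_size.
- move=> i; rewrite /part nth_filter_gt0 //; case: (ltnP i k) => hi.
    by rewrite nth_mkseq.
  by rewrite nth_default ?size_mkseq // f0.
Qed.

Lemma eq_partition lam mu :
  is_partition lam -> is_partition mu -> part lam =1 part mu -> lam = mu.
Proof.
move=> hl hm e; have es i : (i < size lam) = (i < size mu).
  by rewrite !ltn_size_part // e.
apply: (@eq_from_nth _ 0) => [|i _]; last exact: e.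
by have := es (size lam); have := es (size mu); lia.
Qed.

(** * From a hook to a removable rim hook *)

Lemma adjacent_sym : symmetric adjacent.
Proof. by move=> [a b] [c d]; rewrite /adjacent /=; lia. Qed.

Lemma connected_root lam mu root :
    (forall c, in_skew lam mu c -> exists p,
      [/\ path adjacent c p, last c p = root & all (in_skew lam mu) p]) ->
  skew_connected lam mu.
Proof.
move=> H c d hc hd; have [p [pp lp ap]] := H c hc; have [q [pq lq aq]] := H d hd.
exists (p ++ rev (belast d q)); split.
- rewrite cat_path pp lp -lq /= rev_path.
  by rewrite (eq_path (e' := adjacent)) // => x y; rewrite adjacent_sym.
- rewrite last_cat lp -lq; case: q {pq lq aq} => //= a q.
  by rewrite rev_cons last_rcons.
- rewrite all_cat ap all_rev; apply/allP => x /mem_belast.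
  by rewrite inE => /predU1P[->//|]; apply/allP.
Qed.

Ltac if_lia := repeat case: ifP => ?; lia.

(* The removed rim hook follows the boundary from the end of row [i] to the foot of
   column [j]. *)
Lemma rim_hook_exists s lam i j : is_partition lam ->
    in_diagram lam (i, j) -> hook_length lam i j = s ->
  exists mu, rim_hook_removal s lam mu.
Proof.
move=> hl; rewrite /in_diagram /= => hij hs.
have hic : i < conj_part lam j by rewrite ltn_conj_part.
have [q eq_q] : exists q, conj_part lam j = q.+1 by exists (conj_part lam j).-1; lia.
have hq : j < part lam q by rewrite -ltn_conj_part //; lia.
have hq1 : part lam q.+1 <= j by rewrite leqNgt -ltn_conj_part //; lia.
have hiq : i <= q by lia.
have dec m : part lam m.+1 <= part lam m by apply: part_anti.
have lejq m : m <= q -> j < part lam m.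
  by move=> hmq; apply: leq_trans hq _; apply: part_anti.
(* The boundary moves one step along the diagonal: rows [i] to [q - 1] become the next row less one
   cell, and row [q], the foot of column [j], is cut back to length [j]. *)
pose f m := if m < i then part lam m else if m < q then part lam m.+1 - 1
            else if m == q then j else part lam m.
have fdec m : f m.+1 <= f m.
  have h1 := dec m; have h2 := dec m.+1; have h3 := lejq m; have h4 := lejq m.+1.
  rewrite /f; have [e|hm] := eqVneq m q; first by subst m; if_lia.
  by have [e|hm'] := eqVneq m.+1 q; [subst q|]; if_lia.
have f0 m : size lam <= m -> f m = 0.
  move=> hm; have hmz : part lam m = 0 by apply: part_default.
  have hqm : q < m.
    rewrite ltnNge; apply/negP => hmq; have := part_anti _ _ _ hl hmq; lia.
  rewrite /f; if_lia.
have [mu [hm smu pmu]] := partition_exists f (size lam) fdec f0.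
have fle m : f m <= part lam m.
  by have h1 := dec m; have h2 := lejq m; rewrite /f; if_lia.
exists mu; split=> //; first by move=> m; rewrite pmu.
have skE c : in_skew lam mu c = (f c.1 <= c.2) && (c.2 < part lam c.1).
  by rewrite /in_skew pmu.
split.
- rewrite /skew_size (eq_bigr (fun m : 'I__ => part lam m - f m)); last first.
    by move=> m _; rewrite pmu.
  have hqs : q < size lam by rewrite ltn_size_part //; lia.
  rewrite -(big_mkord xpredT (fun m => part lam m - f m)).
  rewrite (big_cat_nat _ (n := i)) //=; last by lia.
  rewrite big_nat big1 ?add0n; last first.
    by move=> m hmi; rewrite /f ifT ?subnn.
  rewrite (big_cat_nat _ (n := q)) //=; last by lia.
  have tl0 : \sum_(q.+1 <= m < size lam) (part lam m - f m) = 0.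
    by rewrite big_nat big1 // => m hmq; rewrite /f; if_lia.
  rewrite (big_ltn hqs) tl0.
  have -> : f q = j by rewrite /f eqxx ltnn; if_lia.
  suff -> : \sum_(i <= m < q) (part lam m - f m) = part lam i - part lam q + (q - i).
    have := part_anti _ _ _ hl hiq; move: hs; rewrite /hook_length; lia.
  (* The sum telescopes, as row [m] loses [part lam m - part lam m.+1 + 1] cells. *)
  have H n : i + n <= q ->
      \sum_(i <= m < i + n) (part lam m - f m) = part lam i - part lam (i + n) + n.
    elim: n => [|n IH] hn; first by rewrite addn0 subnn big_geq.
    rewrite addnS in hn *; rewrite big_nat_recr /=; last by lia.
    rewrite IH; last by lia.
    have := part_anti _ i (i + n) hl; have := dec (i + n); have := lejq (i + n).+1.
    by rewrite /f; if_lia.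
  by rewrite -[X in index_iota _ X](subnKC hiq) H subnKC.
- apply: (connected_root _ _ (q, j)).
  (* From any other cell one can step left or down along the rim. *)
  have H n : forall c, in_skew lam mu c -> q - c.1 + c.2 <= n -> exists p,
      [/\ path adjacent c p, last c p = (q, j) & all (in_skew lam mu) p].
    elim: n => [|n IH] [a b] hc /= hn.
      exists [::]; split=> //; move: hc; rewrite skE /= /f.
      have [haq|haq] := leqP a q; last by if_lia.
      move: (lejq a haq).
      have [haq'|haq'] : a = q \/ a < q by lia.
        by subst a; rewrite ltnn eqxx; case: ifP; [lia|move=> *; congr pair; lia].
      lia.
    have step c : adjacent (a, b) c -> in_skew lam mu c -> q - c.1 + c.2 <= n ->
        exists p, [/\ path adjacent (a, b) p, last (a, b) p = (q, j)
                    & all (in_skew lam mu) p].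
      move=> ac sc hcn; have [p [pp lp ap]] := IH c sc hcn.
      by exists (c :: p); rewrite /= ac sc.
    have hc2 := hc; move: hc2; rewrite skE /= => /andP[hc1 hc2].
    have [hab|hab] := leqP b (f a).
      have {hc1 hab} hb : b = f a by lia.
      have [haq|haq] := eqVneq a q.
        exists [::]; split=> //=; subst a; congr pair; rewrite hb /f eqxx ltnn.
        by case: ltnP => //; lia.
      have [hai|hai] := ltnP a i; first by move: hc2; rewrite hb /f hai; lia.
      have haq' : a < q by move: hc2; rewrite hb /f; if_lia.
      have hbl : b = part lam a.+1 - 1 by rewrite hb /f haq' ltnNge hai.
      apply: (step (a.+1, b)) => /=; last by lia.
        by rewrite /adjacent /=; lia.
      rewrite skE /= hb fdec /= -hb; have := lejq a.+1; lia.
    apply: (step (a, b.-1)) => /=; last by lia.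
      by rewrite /adjacent /=; lia.
    by rewrite skE /=; lia.
  by move=> c hc; apply: (H _ c hc (leqnn _)).
- move=> a b; rewrite !skE /= => -[/andP[h1 _] [_ [_ /andP[_ h2]]]].
  by move: h1 h2 (dec a); rewrite /f; case: (eqVneq a q) => [e|?]; [subst a|]; if_lia.
Qed.

(** * Beads of a partition *)

Definition beads k lam := [seq part lam i + (k - i.+1) | i <- iota 0 k].

Lemma size_beads k lam : size (beads k lam) = k.
Proof. by rewrite size_map size_iota. Qed.

Lemma beadsP k lam x :
  reflect (exists2 i, i < k & x = part lam i + (k - i.+1)) (x \in beads k lam).
Proof. by apply: (iffP mapP) => -[i]; rewrite ?mem_iota => hi ->; exists i; rewrite ?mem_iota. Qed.

Lemma nth_beads k lam i : i < k -> nth 0 (beads k lam) i = part lam i + (k - i.+1).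
Proof. by move=> hi; rewrite (nth_map 0) ?size_iota // nth_iota. Qed.

Lemma gtn_trans : transitive gtn.
Proof. by move=> x y z /=; lia. Qed.

Lemma beads_sorted k lam : is_partition lam -> sorted gtn (beads k lam).
Proof.
move=> hl; apply/(sortedP 0) => i; rewrite size_beads => hi.
rewrite !nth_beads //=; last by lia.
have := part_anti _ i i.+1 hl; lia.
Qed.

Lemma beads_uniq k lam : is_partition lam -> uniq (beads k lam).
Proof.
by move=> hl; apply: (sorted_uniq gtn_trans ltnn); apply: beads_sorted.
Qed.

Lemma beads_inj k lam mu : is_partition lam -> is_partition mu ->
  size lam <= k -> size mu <= k -> beads k lam =i beads k mu -> lam = mu.
Proof.
move=> hl hm sl sm e; apply: eq_partition => // i.
have [hi|hi] := ltnP i k; last by rewrite !part_default //; lia.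
have {}e : beads k lam = beads k mu.
  by apply: (irr_sorted_eq gtn_trans ltnn) e; apply: beads_sorted.
by have := congr1 (nth 0 ^~ i) e; rewrite /= !nth_beads //; lia.
Qed.

Lemma conj_part_le lam j : conj_part lam j <= size lam.
Proof. exact: count_size. Qed.

(* The numbers [k + j - conj_part lam j] are exactly the vacant positions, and the
   hook length at [(i, j)] is the distance from the [i]-th bead to the [j]-th one. *)
Lemma gap_not_bead k lam j : is_partition lam -> size lam <= k ->
  k + j - conj_part lam j \notin beads k lam.
Proof.
move=> hl sl; apply/beadsP => -[m hm].
have := ltn_conj_part lam m j hl; have := conj_part_le lam j.
by have [h1|h1] := ltnP m (conj_part lam j); lia.
Qed.

(** Converse of [gap_not_bead]: if [q] beads exceed the vacant position [y], then column [y + q - k]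
    has length [q]. *)
Lemma not_bead_gap k lam y : is_partition lam -> size lam <= k ->
  y \notin beads k lam -> exists j, y + conj_part lam j = k + j.
Proof.
move=> hl sl hy.
(* The least such [q] is the number of beads above [y]; the alternative [q == k] covers the case
   where all of them are. *)
have ex : exists q, (q == k) || (part lam q + (k - q.+1) < y) by exists k; rewrite eqxx.
case: (ex_minnP ex) => q hq qmin {ex}.
have qk : q <= k by apply: qmin; rewrite eqxx.
have hqy : k <= y + q by lia.
exists (y + q - k); suff -> : conj_part lam (y + q - k) = q by lia.
have H m : (m < conj_part lam (y + q - k)) = (m < q).
  rewrite ltn_conj_part //; have [hm|hm] := ltnP m q.
    have := part_anti _ m q.-1 hl; have : q.-1 < k by lia.
    have : y != part lam q.-1 + (k - q.-1.+1).
      by apply: contra hy => /eqP ->; apply/beadsP; exists q.-1 => //; lia.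
    by have [h1|] := leqP y (part lam q.-1 + (k - q.-1.+1));
      [|move=> h1; have := qmin q.-1; rewrite h1 orbT]; lia.
  have := part_anti _ q m hl hm.
  by case/orP: hq => [/eqP e|?]; [have := part_default lam m; subst q|]; lia.
have := H q; have := H (conj_part lam (y + q - k)); lia.
Qed.

(** A hook length is the distance from a bead down to a vacant position, so a hook of length [s]
    amounts to a bead [x] with [x - s] vacant. *)
Lemma is_coreP s k lam : 0 < s -> is_partition lam -> size lam <= k ->
  is_core s lam <->
  (forall x, x \in beads k lam -> s <= x -> x - s \in beads k lam).
Proof.
move=> s0 hl sl; split=> [hc x /beadsP[i ik ->] sx|hc i j hij hs].
  apply/negPn/negP => /(not_bead_gap _ _ _ hl sl)[j hj].
  have := ltn_conj_part lam i j hl.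
  have [h1|h1] := ltnP i (conj_part lam j); last by lia.
  by move=> /esym h2; apply: (hc i j h2); rewrite /hook_length; lia.
have ik : i < k.
  by rewrite ltnNge; apply/negP => ki; move: hij; rewrite /in_diagram /= part_default //; lia.
have hb : part lam i + (k - i.+1) \in beads k lam by apply/beadsP; exists i.
have := ltn_conj_part lam i j hl; have := conj_part_le lam j.
move: hij hs; rewrite /in_diagram /hook_length /= => hij hs h1; rewrite hij => h2.
have := hc _ hb; have := gap_not_bead k lam j hl sl.
have -> : part lam i + (k - i.+1) - s = k + j - conj_part lam j by lia.
by move=> /negbTE -> ; lia.
Qed.

(** Sorting [X] decreasingly and subtracting the staircase [k - 1 - i] recovers the parts. *)
Lemma unbeads_exists (X : seq nat) : uniq X -> exists lam,
  [&& is_partition lam, size lam <= size X & perm_eq (beads (size X) lam) X].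
Proof.
move=> uX; set k := size X; set b := sort geq X.
have sb : size b = k by rewrite size_sort.
have geq_trans : transitive geq by move=> x y z /=; lia.
have bS i : i.+1 < k -> nth 0 b i.+1 < nth 0 b i.
  move=> hi; have : sorted geq b by apply: sort_sorted => x y /=; lia.
  move=> /(sortedP 0)/(_ i); rewrite sb => /(_ hi) /=.
  have ub : uniq b by rewrite sort_uniq.
  have := nth_uniq 0 _ _ ub; rewrite sb => /(_ i i.+1 (ltnW hi) hi).
  by rewrite [i == _]ltn_eqF // ltn_neqAle => e ->; rewrite eq_sym e.
(* At least [d] distinct naturals follow entry [i], so the subtraction in [f] is never truncated. *)
have bge d i : i + d.+1 = k -> d <= nth 0 b i.
  elim: d i => // d IH i hd; have := IH i.+1; have := bS i; lia.
pose f i := if i < k then nth 0 b i - (k - i.+1) else 0.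
have [|i hi|lam [hl sl pl]] := partition_exists f k.
- move=> i; rewrite /f; have := bS i; if_lia.
- by rewrite /f ltnNge hi.
exists lam; rewrite hl sl /=; suff -> : beads k lam = b by rewrite perm_sort.
apply: (@eq_from_nth _ 0); rewrite size_beads ?sb // => i hi.
rewrite nth_beads // pl /f hi; have := bge (k - i.+1) i; lia.
Qed.

Lemma exists_unbeads : exists F : seq nat -> seq nat, forall X, uniq X ->
  [/\ is_partition (F X), size (F X) <= size X & beads (size X) (F X) =i X].
Proof.
have P X : exists lam, uniq X ==>
    [&& is_partition lam, size lam <= size X & perm_eq (beads (size X) lam) X].
  by case: (boolP (uniq X)) => [/unbeads_exists//|_]; exists [::].
exists (fun X => xchoose (P X)) => X uX.
by have /implyP/(_ uX)/and3P[? ? /perm_mem] := xchooseP (P X).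
Qed.

(** * Rim hook removal on the runners *)

(** Pigeonhole: if [y] is in [Y], so are all smaller numbers, whence [y < size Y]; otherwise all of
    [Y] lies below [y], whence [size Y <= y]. *)
Lemma mem_down_closed (Y : seq nat) y : uniq Y ->
  (forall x, x.+1 \in Y -> x \in Y) -> (y \in Y) = (y < size Y).
Proof.
move=> uY dc.
have down x d : x + d \in Y -> x \in Y.
  by elim: d => [|d IH]; rewrite ?addn0 // addnS => /dc.
apply/idP/idP => [hy|]; last first.
  apply: contraTT => hy; rewrite -leqNgt -[leqRHS](size_iota 0).
  apply: uniq_leq_size => // x hx; rewrite mem_iota /= add0n ltnNge.
  by apply: contra hy => yx; apply: (down y (x - y)); rewrite subnKC.
rewrite -[y.+1](size_iota 0); apply: uniq_leq_size; first exact: iota_uniq.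
move=> x; rewrite mem_iota /= add0n => hx.
by apply: (down x (y - x)); rewrite subnKC.
Qed.

Definition runner_count s r (X : seq nat) := count (fun x => x %% s == r) X.

(** On one runner [x |-> x - s] lowers the quotient by [s] by one, so the quotients form an initial
    segment of the naturals. *)
Lemma runner_down_closed s (X : seq nat) x : 0 < s -> uniq X ->
    (forall x, x \in X -> s <= x -> x - s \in X) ->
  (x \in X) = (x %/ s < runner_count s (x %% s) X).
Proof.
move=> s0 uX dc; pose Y := [seq y %/ s | y <- X & y %% s == x %% s].
have mY z : (z \in Y) = (z * s + x %% s \in X).
  apply/mapP/idP => [[y]|hz].
    by rewrite mem_filter => /andP[/eqP <- yX] ->; rewrite -divn_eq.
  exists (z * s + x %% s); rewrite ?mem_filter ?hz ?modnMDl ?modn_mod ?eqxx //.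
  by rewrite divnMDl // divn_small ?addn0 // ltn_pmod.
rewrite {1}(divn_eq x s) -mY mem_down_closed.
- by rewrite size_map size_filter.
- rewrite map_inj_in_uniq ?filter_uniq // => a b.
  rewrite !mem_filter => /andP[/eqP ea _] /andP[/eqP eb _] e.
  by rewrite (divn_eq a s) (divn_eq b s) e ea eb.
- move=> z; rewrite !mY => /dc; rewrite mulSn -addnA addKn; apply.
  exact: leq_addr.
Qed.

(** Translating by the minimum makes a convex set down-closed. *)
Lemma uniq_convex_iota (C : seq nat) : uniq C ->
    (forall x y z, x \in C -> y \in C -> x <= z -> z <= y -> z \in C) ->
  exists a, perm_eq C (iota a (size C)).
Proof.
move=> uC cv; case: (altP (C =P [::])) => [-> |nC]; first by exists 0.
have ex : exists a, a \in C by case: C nC {uC cv} => // a C _; exists a; rewrite mem_head.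
case: (ex_minnP ex) => a aC amin; exists a.
pose Y := [seq x - a | x <- C].
have mY z : (z \in Y) = (z + a \in C).
  apply/mapP/idP => [[x xC ->]|zC]; first by rewrite subnK // amin.
  by exists (z + a) => //; rewrite addnK.
apply: uniq_perm; rewrite ?iota_uniq // => x.
have uY : uniq Y.
  rewrite map_inj_in_uniq // => u v /amin hu /amin hv; lia.
rewrite mem_iota; case: (leqP a x) => hx /=; last first.
  by apply/negbTE/negP => /amin; lia.
rewrite -[in LHS](subnK hx) -mY mem_down_closed //.
  rewrite size_map; lia.
move=> z; rewrite !mY => hz; apply: (cv a _ _ aC hz); lia.
Qed.

(** Sliding the window trades [a] for [a + s], which lies on the same runner. *)
Lemma runner_count_iotaS s r a :
  runner_count s r (iota a.+1 s) = runner_count s r (iota a s).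
Proof.
have h : a :: iota a.+1 s = rcons (iota a s) (a + s).
  by rewrite -[a :: _]/(iota a s.+1) -addn1 iotaD cats1.
have := congr1 (runner_count s r) h; rewrite /runner_count -cats1 count_cat /= addn0.
rewrite modnDr; lia.
Qed.

Section RimHook.

Variables (s k : nat) (lam mu : seq nat).
Hypotheses (hl : is_partition lam) (sl : size lam <= k)
  (hr : rim_hook_removal s lam mu).

(* Contents of the cells of the skew diagram, shifted by [k - 1]. *)
Let contents : seq nat :=
  [seq k - i.+1 + j | i <- iota 0 k, j <- iota (part mu i) (part lam i - part mu i)].

Let mle i : part mu i <= part lam i. Proof. by case: hr. Qed.
Let hm : is_partition mu. Proof. by case: hr. Qed.

Let in_skew_row c : in_skew lam mu c -> c.1 < k.
Proof.
case/andP=> _ h; rewrite (leq_trans _ sl) // ltn_size_part //; lia.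
Qed.

Let contentsP z : reflect (exists2 c, in_skew lam mu c & z = k - c.1.+1 + c.2)
  (z \in contents).
Proof.
apply: (iffP allpairsPdep) => [[i [j [hi hj ->]]]|[[i j] hc /= ->]].
  exists (i, j) => //; move: hj; rewrite /in_skew mem_iota /=.
  by have := mle i; lia.
exists i, j; rewrite !mem_iota; split=> //.
  exact: in_skew_row hc.
by move: hc (mle i); rewrite /in_skew /=; lia.
Qed.

Let size_contents : size contents = s.
Proof.
case: hr => _ _ _ [<- _ _]; rewrite size_allpairs_dep /skew_size sumnE big_map.
rewrite (eq_bigr (fun i => part lam i - part mu i)); last by move=> i _; rewrite size_iota.
have -> : iota 0 k = index_iota 0 k by rewrite /index_iota subn0.
rewrite (big_cat_nat _ (n := size lam)) ?subn0 //= big_mkord.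
suff -> : \sum_(size lam <= i < k) (part lam i - part mu i) = 0 by rewrite addn0.
by rewrite big_nat big1 // => i /andP[hi _]; rewrite part_default.
Qed.

(* Two cells of equal content would span a square of the skew diagram. *)
Let contents_uniq : uniq contents.
Proof.
apply: allpairs_uniq_dep => [|i _|]; rewrite ?iota_uniq //.
have key i j i' j' : i < i' -> i' < k -> in_skew lam mu (i, j) -> in_skew lam mu (i', j') ->
    k - i.+1 + j = k - i'.+1 + j' -> False.
  move=> ii ik; rewrite /in_skew /= => /andP[h1 h2] /andP[h3 h4] e.
  case: hr => _ _ _ [_ _ /(_ i j)]; apply; rewrite /in_skew /=.
  have := part_anti _ i i' hl (ltnW ii); have := part_anti _ i.+1 i' hl ii.
  have := part_anti _ i i.+1 hl; have := part_anti _ i i.+1 hm; lia.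
move=> [i j] [i' j'] /allpairsPdep[x [y [hx hy [? ?]]]] /allpairsPdep[x' [y' [hx' hy' [? ?]]]] /= e.
subst x y x' y'; move: hx hx' hy hy'; rewrite !mem_iota /= !add0n => hi hi' hj hj'.
have s1 : in_skew lam mu (i, j) by rewrite /in_skew /=; have := mle i; lia.
have s2 : in_skew lam mu (i', j') by rewrite /in_skew /=; have := mle i'; lia.
case: (ltngtP i i') => ii.
- by case: (key _ _ _ _ ii hi' s1 s2 e).
- by case: (key _ _ _ _ ii hi s2 s1 (esym e)).
- by subst i'; congr existT; lia.
Qed.

(* The content changes by at most one along a step of a connecting path. *)
Let contents_convex x y z :
  x \in contents -> y \in contents -> x <= z -> z <= y -> z \in contents.
Proof.
move=> /contentsP[c hc ->] /contentsP[d hd ->].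
case: hr => _ _ _ [_ /(_ c d hc hd)[p [pp lp ap]] _]; rewrite -{}lp {d hd}.
elim: p c hc pp ap => [|c' p IH] c hc /=.
  by move=> _ _ h1 h2; apply/contentsP; exists c => //; lia.
move=> /andP[ac pp] /andP[hc' ap] h1 h2.
have [e|ne] := eqVneq z (k - c.1.+1 + c.2); first by apply/contentsP; exists c.
apply: (IH c') => //; move: ac (in_skew_row _ hc) (in_skew_row _ hc').
rewrite /adjacent; lia.
Qed.

Lemma runner_count_rim_hook r :
  runner_count s r (beads k lam) = runner_count s r (beads k mu).
Proof.
(* Passing from [mu] to [lam], a row moves its bead one step for each skew cell it
   contains; the steps of all rows telescope since the contents form an interval. *)
have row (a b d : nat) :
    ((a + d + b) %% s == r) + count (fun x => x %% s == r) [seq b + j | j <- iota a d] =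
    ((a + b) %% s == r) + count (fun x => x.+1 %% s == r) [seq b + j | j <- iota a d].
  elim: d => [|d IH]; first by rewrite addn0.
  rewrite -addn1 iotaD !map_cat !count_cat /= !addn0.
  by rewrite (addnC b (a + d)) (_ : a + (d + 1) + b = (a + d + b).+1); lia.
have rows (I : seq nat) :
    count (fun x => x %% s == r) [seq part lam i + (k - i.+1) | i <- I] +
    count (fun x => x %% s == r)
      [seq k - i.+1 + j | i <- I, j <- iota (part mu i) (part lam i - part mu i)] =
    count (fun x => x %% s == r) [seq part mu i + (k - i.+1) | i <- I] +
    count (fun x => x.+1 %% s == r)
      [seq k - i.+1 + j | i <- I, j <- iota (part mu i) (part lam i - part mu i)].
  elim: I => //= i I IH; rewrite !count_cat.
  have := row (part mu i) (k - i.+1) (part lam i - part mu i).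
  rewrite (subnKC (mle i)); lia.
have [a pa] := uniq_convex_iota contents contents_uniq contents_convex.
have := rows (iota 0 k); rewrite -/(beads k lam) -/(beads k mu) -/contents.
rewrite !(permP pa) size_contents.
have -> : count (fun x => x.+1 %% s == r) (iota a s) = runner_count s r (iota a.+1 s).
  by rewrite -[a.+1]add1n iotaDl /runner_count count_map.
rewrite runner_count_iotaS; exact: addIn.
Qed.

End RimHook.

(** * Existence and uniqueness of the [s]-core *)

Lemma rim_hook_sumn s lam mu : is_partition lam ->
  rim_hook_removal s lam mu -> \sum_(i < size lam) part lam i = s + \sum_(i < size mu) part mu i.
Proof.
move=> hl [hm hs hle [<- _ _]]; rewrite /skew_size.
have -> : \sum_(i < size mu) part mu i = \sum_(i < size lam) part mu i.
  rewrite -!(big_mkord xpredT (part mu)) [RHS](big_cat_nat _ (n := size mu)) //=.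
  suff -> : \sum_(size mu <= i < size lam) part mu i = 0 by rewrite addn0.
  by rewrite big_nat big1 // => i /andP[hi _]; apply: part_default.
by rewrite -big_split; apply: eq_bigr => i _ /=; rewrite subnK.
Qed.

Lemma rh_reach_inv s k lam nu : rh_reach s lam nu -> is_partition lam -> size lam <= k ->
  [/\ is_partition nu, size nu <= k &
    forall r, runner_count s r (beads k lam) = runner_count s r (beads k nu)].
Proof.
elim=> {lam nu} [lam|lam mu nu hr _ IH] hl sl; first by split.
have [hm sm _ _] := hr; have [|hn sn e] := IH hm; first exact: leq_trans sl.
by split=> // r; rewrite -e; apply: runner_count_rim_hook.
Qed.

Lemma core_exists s lam : 0 < s -> is_partition lam ->
  exists nu, core_is s lam nu.
Proof.
move=> s0; have [n] := ubnP (\sum_(i < size lam) part lam i).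
elim: n lam => // n IH lam hn hl.
have [k sk] : exists k, size lam <= k by exists (size lam).
(* Both tests are finite searches: either the beads are closed and [lam] is a core, or some hook of
   length [s] exists. By [is_coreP] they cannot both fail. *)
case: (boolP (all (fun x => (s <= x) ==> (x - s \in beads k lam)) (beads k lam))).
  move=> /allP h; exists lam; split; first exact: rh_refl.
  apply/(is_coreP _ k) => // x /h /implyP; exact.
move=> hA.
case: (boolP (has (fun i => has (fun j => hook_length lam i j == s)
    (iota 0 (part lam i))) (iota 0 k))).
  move=> /hasP[i _ /hasP[j]]; rewrite mem_iota add0n /= => hj /eqP hs.
  have [mu hr] := rim_hook_exists s lam i j hl hj hs.
  have := rim_hook_sumn s lam mu hl hr; have [hm _ _ _] := hr => e.
  have [|nu [r1 c1]] := IH mu _ hm; first by lia.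
  by exists nu; split=> //; apply: rh_step hr r1.
move=> /hasPn nh; case/negP: hA; apply/allP => x hx; apply/implyP; move: x hx.
apply/is_coreP => // i j hij hs.
have ik : i < k.
  by apply: leq_trans sk; rewrite ltn_size_part //; move: hij; rewrite /in_diagram /=; lia.
have := nh i; rewrite mem_iota ik => /(_ isT) /hasPn/(_ j).
by rewrite mem_iota add0n => /(_ hij); rewrite hs eqxx.
Qed.

Lemma core_unique s k mu nu : 0 < s -> is_partition mu -> is_partition nu ->
    size mu <= k -> size nu <= k -> is_core s mu -> is_core s nu ->
    (forall r, r < s ->
       runner_count s r (beads k mu) = runner_count s r (beads k nu)) ->
  mu = nu.
Proof.
move=> s0 hm hn sm sn cm cn e; apply: (beads_inj k) => // x.
rewrite !(runner_down_closed s) ?beads_uniq ?e ?ltn_pmod //; exact/is_coreP.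
Qed.

(** No confluence argument is needed for the converse: [lam] reaches some core, removals preserve
    the runner counts, and these counts determine a core. *)
Lemma core_isP s k lam sigma : 0 < s -> is_partition lam -> is_partition sigma ->
    size lam <= k -> size sigma <= k -> is_core s sigma ->
  core_is s lam sigma <-> (forall r, r < s ->
    runner_count s r (beads k lam) = runner_count s r (beads k sigma)).
Proof.
move=> s0 hl hs sl ss cs; split=> [[h _] r _|e].
  by have [_ _] := rh_reach_inv s k lam sigma h hl sl.
have [nu [hr cn]] := core_exists s lam s0 hl.
have [hn sn e'] := rh_reach_inv s k lam nu hr hl sl.
suff -> : sigma = nu by split.
by apply: (core_unique s k) => // r rs; rewrite -e // e'.
Qed.

(** * Counting cores *)

(** Weak compositions of [n] into [m.+1] parts, taken from tuples of bounded ordinals so that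
    [card_ord_partitions] counts them. *)
Definition compositions m n : seq (seq nat) :=
  [seq [seq val i | i <- val l]
     | l : m.+1.-tuple 'I_n.+1 in [set l : m.+1.-tuple 'I_n.+1 | \sum_(i <- l) i == n]].

Lemma mem_compositions m n (l : seq nat) :
  (l \in compositions m n) = (size l == m.+1) && (sumn l == n).
Proof.
apply/imageP/andP => [[x]|[/eqP sl /eqP nl]].
  rewrite inE => hx ->; rewrite size_map size_tuple eqxx; split=> //.
  by rewrite sumnE big_map.
(* No entry exceeds the total, so [inord] below alters nothing. *)
have hle i : i \in l -> i < n.+1.
  move=> il; rewrite ltnS -nl sumnE (big_rem i) //=; exact: leq_addr.
pose l' : seq 'I_n.+1 := [seq inord i | i <- l].
have e : [seq val i | i <- l'] = l.
  by rewrite -map_comp map_id_in // => i il /=; rewrite inordK // hle.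
have sz : size l' == m.+1 by rewrite size_map sl.
exists (Tuple sz); last by rewrite /= e.
by rewrite inE -[X in _ == X]nl sumnE -[X in _ == \sum_(i <- X) _]e big_map.
Qed.

Lemma compositions_uniq m n : uniq (compositions m n).
Proof.
rewrite map_inj_uniq ?enum_uniq // => x y e.
by apply: val_inj; apply: inj_map e; apply: val_inj.
Qed.

Lemma size_compositions m n : size (compositions m n) = 'C(m + n, m).
Proof. by rewrite size_map -cardE card_ord_partitions. Qed.

Fixpoint choices {T : Type} (ls : seq (seq T)) : seq (seq T) :=
  if ls is l :: ls' then [seq x :: y | x <- l, y <- choices ls'] else [:: [::]].

Lemma mem_choices {T : eqType} (ls : seq (seq T)) y x0 :
  y \in choices ls <-> size y = size ls /\
    (forall i, i < size ls -> nth x0 y i \in nth [::] ls i).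
Proof.
elim: ls y => [|l ls IH] y /=.
  by rewrite inE; split=> [/eqP ->//|[/size0nil ->]].
split=> [/allpairsP[[a b] /= [al /IH[sb hb] ->]]|[]].
  by split=> /=; [rewrite sb | case].
case: y => //= a y [sy] h; apply/allpairsP; exists (a, y); split=> //=.
  exact: (h 0).
by apply/IH; split=> // i hi; apply: (h i.+1).
Qed.

Lemma choices_uniq {T : eqType} (ls : seq (seq T)) : all uniq ls -> uniq (choices ls).
Proof.
elim: ls => //= l ls IH /andP[ul uls]; apply: allpairs_uniq; rewrite ?IH //.
by move=> [a b] [c d] _ _ /= [-> ->].
Qed.

Lemma size_choices {T : Type} (ls : seq (seq T)) :
  size (choices ls) = \prod_(l <- ls) size l.
Proof.
by elim: ls => [|l ls IH] /=; rewrite ?big_nil // size_allpairs IH big_cons.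
Qed.

(** * Splitting runners and rebuilding bead sets *)

(** The residues modulo [s * t] lying over [r] modulo [s] are exactly the [r + s * v] with
    [v < t]. *)
Lemma runner_count_refine s t r X : r < s -> 0 < t ->
  runner_count s r X = \sum_(v < t) runner_count (s * t) (r + s * v) X.
Proof.
move=> rs t0; elim: X => [|x X IH]; first by rewrite big1.
rewrite /runner_count /= big_split /= -/(runner_count s r X) IH; congr addn.
have s0 : 0 < s by lia.
have em : x %% (s * t) %% s = x %% s by rewrite modn_dvdm // dvdn_mulr.
have hv : x %% (s * t) %/ s < t.
  by rewrite ltn_divLR // [t * s]mulnC ltn_pmod // muln_gt0 s0.
have split_eq v : (x %% (s * t) == r + s * v) = (x %% s == r) && (x %% (s * t) %/ s == v).
  apply/eqP/andP => [e|[/eqP <- /eqP <-]].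
    rewrite -em e addnC mulnC modnMDl modn_small // divnMDl // divn_small //.
    by rewrite addn0 !eqxx.
  by rewrite {1}(divn_eq (x %% (s * t)) s) em mulnC addnC.
under eq_bigr => v _ do rewrite split_eq.
case: eqP => _ /=; last by rewrite big1.
rewrite (bigD1 (Ordinal hv)) //= eqxx big1 ?addn0 // => v.
by rewrite -val_eqE /= eq_sym => /negbTE ->.
Qed.

Lemma sum_runner_count s (X : seq nat) : 0 < s -> \sum_(r < s) runner_count s r X = size X.
Proof.
(* Modulo 1 there is a single runner, holding all of [X]; it is refined into [s] runners. *)
move=> s0; have := runner_count_refine 1 s 0 X isT s0.
rewrite mul1n /runner_count (eq_count (a2 := predT)) ?count_predT => [->|x].
  by apply: eq_bigr => v _; apply: eq_count => x; rewrite add0n mul1n.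
by rewrite modn1.
Qed.

(** The configuration whose runner [u] holds [n u] beads pushed down to the lowest positions, as in
    a [T]-core. *)
Definition of_runners T (n : nat -> nat) : seq nat :=
  [seq u + T * y | u <- iota 0 T, y <- iota 0 (n u)].

Lemma mem_of_runners T n x : 0 < T -> (x \in of_runners T n) = (x %/ T < n (x %% T)).
Proof.
move=> T0; apply/allpairsPdep/idP => [[u [y []]]|hx].
  rewrite !mem_iota /= !add0n => uT yn ->.
  by rewrite mulnC addnC modnMDl divnMDl // modn_small // divn_small // addn0.
exists (x %% T), (x %/ T); rewrite !mem_iota /= ltn_pmod //; split=> //.
by rewrite mulnC addnC -divn_eq.
Qed.

Lemma of_runners_uniq T n : 0 < T -> uniq (of_runners T n).
Proof.
move=> T0; apply: allpairs_uniq_dep => [|u _|]; rewrite ?iota_uniq //.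
move=> [u y] [u' y'] /allpairsPdep[a [b [ha hb [? ?]]]] /allpairsPdep[a' [b' [ha' hb' [? ?]]]] /= e.
subst a b a' b'; move: ha ha'; rewrite !mem_iota !add0n /= => hu hu'.
have eu : u = u'.
  by have := congr1 (modn ^~ T) e; rewrite /= ![_ + T * _]addnC ![T * _]mulnC !modnMDl !modn_small.
subst u'; congr existT; move/eqP: e; rewrite eqn_add2l eqn_pmul2l //; exact/eqP.
Qed.

Lemma runner_count_of_runners T n u : u < T ->
  runner_count T u (of_runners T n) = n u.
Proof.
move=> uT; have T0 : 0 < T by lia.
rewrite /runner_count -size_filter -[RHS](size_iota 0) -[RHS](size_map (fun y => u + T * y)).
apply/perm_size/uniq_perm; first by apply: filter_uniq; apply: of_runners_uniq.
  rewrite map_inj_uniq ?iota_uniq // => y y' /eqP.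
  by rewrite eqn_add2l eqn_pmul2l // => /eqP.
move=> x; rewrite mem_filter mem_of_runners //.
apply/andP/mapP => [[/eqP e hx]|[y]].
  exists (x %/ T); rewrite ?mem_iota -?e //.
  by rewrite mulnC addnC -divn_eq.
rewrite mem_iota /= add0n => hy ->.
by rewrite mulnC addnC modnMDl divnMDl // modn_small // divn_small // addn0.
Qed.

Lemma eq_runner_count s r X Y : uniq X -> uniq Y -> X =i Y ->
  runner_count s r X = runner_count s r Y.
Proof. by move=> uX uY e; apply/permP/uniq_perm. Qed.

Lemma count_cores s t k sigma : 0 < s -> 0 < t ->
    is_partition sigma -> is_core s sigma -> size sigma <= k ->
  exists L : seq (seq nat),
    [/\ uniq L,
        (forall lam, lam \in L <->
           [/\ is_partition lam, is_core (s * t) lam, core_is s lam sigma & size lam <= k]) &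
        size L = \prod_(r < s) 'C(t.-1 + runner_count s r (beads k sigma), t.-1)].
Proof.
move=> s0 t0 hs cs ss; set T := s * t.
have T0 : 0 < T by rewrite muln_gt0 s0.
pose c r := runner_count s r (beads k sigma).
pose Ls := choices [seq compositions t.-1 (c r) | r <- iota 0 s].
have LsP N : N \in Ls <-> size N = s /\ (forall r, r < s ->
    size (nth [::] N r) = t /\ sumn (nth [::] N r) = c r).
  rewrite /Ls (mem_choices _ _ [::]) size_map size_iota.
  split=> -[sN h]; split=> // r rs; have := h r rs;
    rewrite (nth_map 0) ?size_iota // nth_iota // add0n mem_compositions prednK //.
    by move=> /andP[/eqP ? /eqP].
  by move=> [-> ->]; rewrite !eqxx.
(* [N] is a table with [s] rows and [t] columns; entry [v] of row [r] is the bead number for runner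
   [r + s * v] modulo [T]. *)
pose ent (N : seq (seq nat)) u := nth 0 (nth [::] N (u %% s)) (u %/ s).
pose X N := of_runners T (ent N).
have uX N : uniq (X N) by apply: of_runners_uniq.
have entE N r v : r < s -> ent N (r + s * v) = nth 0 (nth [::] N r) v.
  move=> rs; rewrite /ent addnC mulnC modnMDl divnMDl // modn_small // divn_small //.
  by rewrite addn0.
have ltT r v : r < s -> v < t -> r + s * v < T.
  move=> rs vt; apply: (@leq_trans (s * v.+1)); first by rewrite mulnS ltn_add2r.
  by rewrite leq_mul2l vt orbT.
have rcX N r : N \in Ls -> r < s -> runner_count s r (X N) = c r.
  move=> /LsP[_ h] rs; have [h1 <-] := h r rs; rewrite (runner_count_refine s t) //.
  rewrite sumnE (big_nth 0) h1 big_mkord; apply: eq_bigr => v _.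
  by rewrite runner_count_of_runners ?ltT // entE.
(* The beads of [X N] are as many as those of [sigma], so [F] decodes them with the same [k]. *)
have szX N : N \in Ls -> size (X N) = k.
  move=> hN; rewrite -(sum_runner_count s) // -[RHS](size_beads k sigma).
  rewrite -(sum_runner_count s (beads k sigma)) //.
  by apply: eq_bigr => r _; apply: rcX.
have [F hF] := exists_unbeads.
have FX N : N \in Ls -> [/\ is_partition (F (X N)), size (F (X N)) <= k
    & beads k (F (X N)) =i X N].
  by move=> hN; rewrite -(szX N hN); apply: hF.
exists [seq F (X N) | N <- Ls]; split.
- rewrite map_inj_in_uniq; last first.
    move=> N N' hN hN' e; have [_ _ b1] := FX _ hN; have [_ _ b2] := FX _ hN'.
    have eX : X N =i X N' by move=> x; rewrite -b1 -b2 e.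
    have [s1 h1] := (LsP N).1 hN; have [s2 h2] := (LsP N').1 hN'.
    apply: (@eq_from_nth _ [::]) => [|r]; rewrite s1 ?s2 // => rs.
    have [q1 _] := h1 r rs; have [q2 _] := h2 r rs.
    apply: (@eq_from_nth _ 0) => [|v]; rewrite q1 ?q2 // => vt.
    (* Each table entry is recovered as a bead count of [X N], hence injectivity. *)
    rewrite -!entE // -(runner_count_of_runners T (ent N)) ?ltT //.
    rewrite -(runner_count_of_runners T (ent N')) ?ltT //.
    exact: (eq_runner_count _ _ _ _ (uX N) (uX N') eX).
  apply: choices_uniq; apply/allP => l /mapP[r _ ->]; exact: compositions_uniq.
- move=> lam; split=> [/mapP[N hN ->]|[hl cl cis sl]].
    have [p1 p2 p3] := FX N hN; split=> //.
      apply/(is_coreP _ k) => // x; rewrite !p3 !mem_of_runners // => hx Tx.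
      (* Passing to [x - T] keeps the residue and lowers the quotient by one, so it stays within the
         lowest positions. *)
      have e : x = 1 * T + (x - T) by rewrite mul1n subnKC.
      by move: hx; rewrite {1 2}e divnMDl // modnMDl; lia.
    apply/(core_isP s k) => // r rs; rewrite -[RHS](rcX N) //.
    by apply: eq_runner_count; rewrite ?beads_uniq.
  (* The table is read off from the [T]-runners of [lam]; its beads are pushed down since [lam] is a
     [T]-core, so the table determines [lam]. *)
  pose N := mkseq (fun r => mkseq (fun v => runner_count T (r + s * v) (beads k lam)) t) s.
  have hN : N \in Ls.
    apply/LsP; split=> [|r rs]; first exact: size_mkseq.
    rewrite nth_mkseq // size_mkseq; split=> //.
    have /(core_isP s k) e := cis; rewrite /c -e // (runner_count_refine s t) //.
    by rewrite sumnE big_map -[X in iota 0 X](subn0 t) big_mkord.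
  have [p1 p2 p3] := FX N hN; apply/mapP; exists N => //.
  apply: (beads_inj k) => // x; rewrite p3 mem_of_runners //.
  rewrite (runner_down_closed T) ?beads_uniq //; last exact/is_coreP.
  congr (_ < _); set u := x %% T; have uT : u < T by rewrite ltn_pmod.
  have -> : u = u %% s + s * (u %/ s) by rewrite mulnC addnC -divn_eq.
  rewrite entE ?ltn_pmod // nth_mkseq ?ltn_pmod // nth_mkseq //.
  by rewrite ltn_divLR // mulnC.
- rewrite size_map size_choices big_map -[X in iota 0 X](subn0 s) big_mkord.
  by apply: eq_bigr => r _; rewrite size_compositions.
Qed.

(** * Dependence on [k] and the constituent polynomials *)

Lemma runner_count_iota s r : r < s -> runner_count s r (iota 0 s) = 1.
Proof.
move=> rs; rewrite /runner_count (eq_in_count (a2 := pred1 r)).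
  by rewrite count_uniq_mem ?iota_uniq // mem_iota rs.
by move=> x; rewrite mem_iota add0n => /andP[_ xs] /=; rewrite modn_small.
Qed.

(** Adding [s] empty rows shifts every bead by [s] and inserts the beads [0] to [s - 1], one on each
    runner. *)
Lemma runner_count_beadsD s r k n lam : r < s -> is_partition lam -> size lam <= k ->
  runner_count s r (beads (k + n * s) lam) = runner_count s r (beads k lam) + n.
Proof.
move=> rs hl sl; elim: n => [|n IH]; first by rewrite mul0n !addn0.
rewrite addnS -{}IH mulSn addnCA; set m := k + n * s.
have sm : size lam <= m by rewrite /m; lia.
have -> : runner_count s r (beads (s + m) lam) =
    runner_count s r ([seq x + s | x <- beads m lam] ++ iota 0 s).
  apply: eq_runner_count; rewrite ?beads_uniq //.
    rewrite cat_uniq iota_uniq (map_inj_uniq (@addIn s)) beads_uniq // andbT /=.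
    by apply/hasPn => x; rewrite mem_iota => xs; apply/mapP => -[y _]; lia.
  move=> x; rewrite mem_cat mem_iota /=; apply/beadsP/orP.
    move=> [i hi ->]; have [im|im] := ltnP i m.
      left; apply/mapP; exists (part lam i + (m - i.+1)); last lia.
      by apply/beadsP; exists i.
    by right; rewrite part_default; lia.
  case=> [/mapP[y /beadsP[i hi ->] ->]|xs]; first by exists i; lia.
  by exists (s + m - x.+1); rewrite ?part_default; lia.
rewrite /runner_count count_cat count_map -/(runner_count s r (iota 0 s)).
rewrite runner_count_iota // addn1; congr (_.+1); apply: eq_count => x /=.
by rewrite modnDr.
Qed.

Local Open Scope ring_scope.

(** The product over [r < s] of the binomials [m + a r + X] choose [m], given by its roots so that
    degree and leading coefficient can be read off. *)
Definition prod_bin_poly (s m : nat) (a : nat -> rat) : {poly rat} :=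
  (m`!)%:R ^- s *:
    \prod_(z <- [seq - (a r + (m - j)%:R) | r <- iota 0 s, j <- iota 0 m]) ('X - z%:P).

Lemma fact_expVn_neq0 s m : (m`!)%:R ^- s != 0 :> rat.
Proof. by rewrite invr_eq0 expf_neq0 // pnatr_eq0 -lt0n fact_gt0. Qed.

Lemma size_prod_bin_poly s m a : size (prod_bin_poly s m a) = (s * m).+1.
Proof.
rewrite size_scale ?fact_expVn_neq0 // size_prod_XsubC size_allpairs.
by rewrite !size_iota.
Qed.

Lemma lead_coef_prod_bin_poly s m a : lead_coef (prod_bin_poly s m a) = (m`!)%:R ^- s.
Proof. by rewrite lead_coefZ (monicP (monic_prod_XsubC _ _ _)) mulr1. Qed.

(** After multiplication by [m!] each binomial is a falling factorial, whose [m] factors match the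
    linear factors for the same [r]. *)
Lemma horner_prod_bin_poly s m a (n : nat) (c : nat -> nat) :
    (forall r, (r < s)%N -> (c r)%:R = a r + n%:R) ->
  (prod_bin_poly s m a).[n%:R] = (\prod_(r < s) 'C(m + c r, m))%:R.
Proof.
move=> hc; rewrite hornerZ horner_prod big_allpairs_dep /=.
apply: (canLR (mulKf _)); first by rewrite -invr_eq0 fact_expVn_neq0.
rewrite -[X in _ ^+ X](card_ord s) -prodr_const -natr_prod -natrM -big_split /=.
rewrite -[X in iota 0 X](subn0 s) big_mkord natr_prod; apply: eq_bigr => r _.
rewrite mulnC bin_ffact ffact_prod natr_prod -[X in iota 0 X](subn0 m) big_mkord.
apply: eq_bigr => j _; rewrite !hornerE opprK.
have jm := ltnW (ltn_ord j).
(* As [j < m], the natural difference [m + c r - j] equals [m - j + c r] without truncation. *)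
by rewrite -addnBAC // natrD hc // addrC addrAC addrC.
Qed.

Theorem theorem4 (s t : nat) (hs : (0 < s)%N) (ht : (0 < t)%N) (sigma : seq nat) :
  is_partition sigma -> is_core s sigma ->
  exists (Q : nat -> rat) (P : nat -> {poly rat}),
    (* Q is a quasipolynomial of period s with constituents P_0, ..., P_{s-1} *)
    [/\ (forall i n, (i < s)%N -> Q (i + n * s)%N = (P i).[n%:R]),
        (* each constituent has degree s(t-1) and leading coefficient 1/((t-1)!)^s *)
        (forall i, (i < s)%N ->
           size (P i) = (s * t.-1).+1 /\ lead_coef (P i) = ((t.-1)`!)%:R ^- s) &
        (* N_sigma(k) = Q(k) for all k >= l(sigma) *)
        (forall k, (size sigma <= k)%N ->
           exists L : seq (seq nat),
             [/\ uniq L,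
                 (forall lam, lam \in L <->
                    [/\ is_partition lam, is_core (s * t) lam,
                        core_is s lam sigma & (size lam <= k)%N]) &
                 (size L)%:R = Q k])].
Proof.
move=> hp hc.
pose c k r := runner_count s r (beads k sigma).
pose M := size sigma.
(* For [i < size sigma], [i] beads cannot encode [sigma], so the count is taken at
   [i + M * s >= size sigma] and extrapolated back by [M] steps. The result may be negative. *)
pose a i r : rat := (c (i + M * s)%N r)%:R - M%:R.
pose P i := prod_bin_poly s t.-1 (a i).
exists (fun k => (P (k %% s)%N).[(k %/ s)%:R]), P; split.
- by move=> i n si; rewrite addnC modnMDl divnMDl // modn_small // divn_small // addn0.
- by move=> i _; rewrite size_prod_bin_poly lead_coef_prod_bin_poly.
move=> k sk; have [L [uL mL sL]] := count_cores s t k sigma hs ht hp hc sk.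
exists L; split=> //; rewrite sL.
apply/esym/(horner_prod_bin_poly _ _ _ _ (c k)) => r rs; rewrite /a.
(* With [M] added, both sides count the beads for [k + M * s], reached from [k] on one side and from
   [k %% s + M * s] on the other. *)
apply: (addIr M%:R); rewrite addrAC subrK -!natrD.
rewrite -(runner_count_beadsD s r k M sigma) // -(runner_count_beadsD s r _ (k %/ s) sigma) //.
  by congr (runner_count _ _ (beads _ _))%:R; rewrite {1}(divn_eq k s); lia.
rewrite -/M; apply: (@leq_trans (M * s)%N); first exact: leq_pmulr.
exact: leq_addl.
Qed.
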